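(* Let $r$ be a positive integer and let $$h(X)=\sum_{0\le i<(q+1)/d,\ 0\le j<d}a_{ij}X^{i+j(q+1)/d}\in\mathbb F_{q^2}[X],\qquad M_{ik}=\sum_{j=0}^{d-1}a_{ij}\epsilon^{jk}\ \ (0\le i<(q+1)/d,\ 0\le k<d).$$ Then $X^rh(X^{q-1})$ is a permutation polynomial of $\mathbb F_{q^2}$ such that, for every $0\le k<d$, the function $x\mapsto x^rh(x)^{q-1}$ restricted to $A_k$ is of the form $x\mapsto c_kx^{n_k}$ for some $c_k\in\mathbb F_{q^2}$ and integer $n_k$, if and only if the following three conditions hold: (i) for each $0\le k<d$ there exist integers $s_k,t_k\ge0$ with $s_k+t_k<(q+1)/d$, an element $\pi(k)\in\mathbb Z/d\mathbb Z$, an element $\lambda_k\in A_{\pi(k)}$, and an integer $\tau_k\in\{0\}\cup[(q+1)/d-t_k,\,t_k]$, such that $\sum_iM_{ik}X^i=X^{s_k}L_k(X)$ with $L_k\in\mathcal L_k(t_k,\tau_k;\lambda_k)$; (ii) $\gcd(r,q-1)=1$ and $\gcd(e_k,(q+1)/d)=1$ for all $0\le k<d$, where $e_k=r-2s_k-t_k+\tau_k$; (iii) the map $k\mapsto\pi(k)+e_kk$ permutes $\mathbb Z/d\mathbb Z$.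
   Context: $q$ is a prime power, $d$ is a positive divisor of $q+1$, and $\epsilon\in\mathbb F_{q^2}^*$ has multiplicative order $d$. $\mu_m$ denotes the subgroup of order $m$ of $\mathbb F_{q^2}^*$. For $0\le k<d$ (indices read mod $d$), $A_k=\{x\in\mu_{q+1}: x^{(q+1)/d}=\epsilon^k\}$. For $a\in\mathbb F_{q^2}$, $\bar a=a^q$; for $f(X)=\sum_{i=0}^n a_iX^i\in\mathbb F_{q^2}[X]$ with $a_n\neq0$, $\tilde f(X)=\sum_{i=0}^n\bar a_iX^{n-i}$. For $0\le k<d$, $0\le t<(q+1)/d$ and $\lambda\in\mu_{q+1}$: $\mathcal L_k(t,0;\lambda)$ is the set of $L\in\mathbb F_{q^2}[X]$ with $\deg L=t$, $\tilde L=\lambda L$ and $\gcd(L,X^{(q+1)/d}-\epsilon^k)=1$; and for an integer $\tau$ with $(q+1)/d-t\le\tau\le t$, $\mathcal L_k(t,\tau;\lambda)$ is the set of polynomials $L=P+X^{(q+1)/d-\tau}Q$ with $P,Q\in\mathbb F_{q^2}[X]$, $\deg P=t-\tau$, $\tilde P=\lambda P$, $\deg Q=\tau+t-(q+1)/d$, $\tilde Q=\lambda\epsilon^kQ$, and $\gcd(L,X^{(q+1)/d}-\epsilon^k)=1$. *)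

(* Defs.v *)
From HB Require Import structures.
From mathcomp Require Import all_boot all_order all_algebra all_field.
Set Implicit Arguments. Unset Strict Implicit. Unset Printing Implicit Defensive.
Import Order.TTheory GRing.Theory Num.Theory.
Local Open Scope ring_scope.

(* F plays the role of F_{q^2}; conjugation  a |-> a^q. *)

Definition Aset (F : fieldType) (q d : nat) (eps : F) (k : nat) (x : F) : bool :=
  (x ^+ q.+1 == 1) && (x ^+ (q.+1 %/ d)%N == eps ^+ k).

Definition tilde (F : fieldType) (q : nat) (f : {poly F}) : {poly F} :=
  \poly_(i < size f) ((f`_((size f).-1 - i)) ^+ q).

(* membership L \in \mathcal L_k(t, tau; lam), m = (q+1)/d.
   For tau <> 0 the paper assumes m - t <= tau <= t (imposed in the theorem). *)
Definition Lset (F : fieldType) (q d : nat) (eps : F) (k t tau : nat) (lam : F)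
    (L : {poly F}) : Prop :=
  let m := (q.+1 %/ d)%N in
  if tau == 0%N then
    [/\ size L = t.+1, tilde q L = lam *: L & coprimep L ('X^m - (eps ^+ k)%:P)]
  else
    exists P Q : {poly F},
      L = P + 'X^(m - tau) * Q /\
      [/\ size P = (t - tau).+1, tilde q P = lam *: P,
          size Q = (tau + t - m).+1, tilde q Q = (lam * eps ^+ k) *: Q
        & coprimep L ('X^m - (eps ^+ k)%:P)].

Definition perm_poly (F : finFieldType) (p : {poly F}) : Prop :=
  injective (fun x : F => p.[x]).

Definition ek (r s t tau : nat) : int :=
  (r%:Z - 2 * s%:Z - t%:Z + tau%:Z)%R.

(* Main.v *)
(* The map X^r h(X^(q-1)) permutes F_(q^2) iff gcd(r, q-1) = 1 and g(x) = x^r h(x)^(q-1) permutes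
   mu_(q+1).  On A_k, where x^m = eps^k, h agrees with N_k = sum_i M_ik X^i, and g = c x^n there
   says that N_k(x)^q is a monomial times N_k(x).  Writing N_k = X^s L with L(0) <> 0 and using
   x^q = 1/x, this is tilde L(x) = lam x^tau L(x) on A_k with 0 <= tau < m.  Reducing X^tau L modulo
   X^m - eps^k turns it into an identity of polynomials of degree < m, whose coefficients give
   membership in L_k(t, tau; lam).  Conversely such an L makes g equal to lam_k x^(e_k) on A_k, so g
   sends A_k to A_(pi(k) + e_k k), and injectivity is checked class by class. *)
Require Import Defs.
From HB Require Import structures.
From mathcomp Require Import all_boot all_order all_algebra all_field.
From mathcomp Require Import zify ring.
Set Implicit Arguments. Unset Strict Implicit. Unset Printing Implicit Defensive.
Import Order.TTheory GRing.Theory Num.Theory.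
Local Open Scope ring_scope.

(** * Integer powers on the group of [n]-th roots of unity *)

Section RootsOfUnity.
Variable F : fieldType.
Implicit Types (x z w : F) (n : nat) (e : int).

Lemma unity_neq0 x n : (0 < n)%N -> x ^+ n = 1 -> x != 0.
Proof.
move=> n_gt0 xn1; apply/eqP => x0.
by move/eqP: xn1; rewrite x0 expr0n gtn_eqF // eq_sym oner_eq0.
Qed.

Lemma expfz_nat_mul x n e : x ^ (e * n%:Z) = (x ^+ n) ^ e.
Proof. by rewrite exprnP exprz_exp mulrC. Qed.

(** Bezout: with [u * e + v * n = 1], [z] is a product of powers of [z ^ e] and [z ^+ n]. *)
Lemma coprimez_unity_eq1 n e z : (0 < n)%N -> coprimez e n%:Z ->
  z ^+ n = 1 -> z ^ e = 1 -> z = 1.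
Proof.
move=> n_gt0 /coprimezP[[u v] /= uv1] zn1 ze1.
rewrite -[z]expr1z -uv1 expfzDr ?(unity_neq0 n_gt0 zn1)//.
by rewrite expfz_nat_mul zn1 [u * e]mulrC -exprz_exp ze1 !exp1rz mulr1.
Qed.

(** Surjectivity counterpart of the previous lemma: the Bezout coefficient [u] of [e] inverts the
    [e]-th power map, so [w ^ u] is the root. *)
Lemma coprimez_unity_root n e w : (0 < n)%N -> coprimez e n%:Z ->
  w ^+ n = 1 -> exists2 z, z ^+ n = 1 & z ^ e = w.
Proof.
move=> n_gt0 /coprimezP[[u v] /= uv1] wn1; exists (w ^ u).
  by rewrite exprnP exprzAC -exprnP wn1 exp1rz.
rewrite exprz_exp -[RHS]expr1z -uv1 expfzDr ?(unity_neq0 n_gt0 wn1)//.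
by rewrite expfz_nat_mul wn1 exp1rz mulr1.
Qed.

(** Converse: for [g = gcd(e, n)] the element [w ^+ (n %/ g)] has order [g] and is killed by both
    [n] and [e]. If it must be 1, then [n] divides [n %/ g], which forces [g = 1]. *)
Lemma unity_eq1_coprimez n e w : n.-primitive_root w ->
  (forall z, z ^+ n = 1 -> z ^ e = 1 -> z = 1) -> coprimez e n%:Z.
Proof.
move=> wP triv; have n_gt0 := prim_order_gt0 wP.
set g := gcdn `|e| n.
have gn : (g %| n)%N by rewrite dvdn_gcdr.
have /dvdzP[f ef] : (g%:Z %| e)%Z by rewrite dvdzE /= dvdn_gcdl.
have zg : (w ^+ (n %/ g)) ^+ g = 1.
  by rewrite -exprM divnK // (prim_expr_order wP).
have z1 : w ^+ (n %/ g) = 1.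
  apply: triv; first by rewrite exprAC (prim_expr_order wP) expr1n.
  by rewrite ef expfz_nat_mul zg exp1rz.
have : (n %| n %/ g)%N by rewrite (prim_order_dvd wP) z1.
have g_gt0 : (0 < g)%N by rewrite gcdn_gt0 n_gt0 orbT.
move=> /dvdn_leq; rewrite divn_gt0 // => /(_ (dvdn_leq n_gt0 gn)) le_n.
rewrite coprimezE /coprime -/g eqn_leq g_gt0 andbT leqNgt; apply/negP => g_gt1.
by move: le_n; rewrite leqNgt ltn_Pdiv.
Qed.

Lemma prim_expz_mod n z e : n.-primitive_root z -> z ^ (e %% n%:Z)%Z = z ^ e.
Proof.
move=> zP; have n_gt0 := prim_order_gt0 zP.
have z0 : z != 0 by apply: (unity_neq0 n_gt0); exact: prim_expr_order.
rewrite [in RHS](divz_eq e n%:Z) [RHS]expfzDr //.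
by rewrite expfz_nat_mul (prim_expr_order zP) exp1rz mul1r.
Qed.

Lemma eq_prim_root_expz n z e1 e2 : n.-primitive_root z ->
  (z ^ e1 == z ^ e2) = ((e1 %% n%:Z)%Z == (e2 %% n%:Z)%Z).
Proof.
move=> zP; have n0 : n%:Z != 0 by have := prim_order_gt0 zP; lia.
apply/eqP/eqP => [|E]; last by rewrite -(prim_expz_mod e1 zP) E prim_expz_mod.
rewrite -(prim_expz_mod e1 zP) -(prim_expz_mod e2 zP).
have := ltz_mod e1 n0; have := ltz_mod e2 n0.
have := modz_ge0 e1 n0; have := modz_ge0 e2 n0.
case: (e1 %% n%:Z)%Z => // a; case: (e2 %% n%:Z)%Z => // b _ _ ltb lta.
by rewrite -!exprnP => /eqP; rewrite (eq_prim_root_expr zP) !modn_small; lia.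
Qed.

End RootsOfUnity.

(** The nonzero elements are [#|F|.-1] distinct roots of unity of that order, enough for one of them
    to be primitive; a suitable power of it has order [n]. *)
Lemma finField_prim_root (F : finFieldType) n : (n %| #|F|.-1)%N ->
  exists w : F, n.-primitive_root w.
Proof.
move=> n_dvd; have F1 : (1 < #|F|)%N by exact: finNzRing_gt1.
have N_gt0 : (0 < #|F|.-1)%N by lia.
suff /hasP[w _ wP] : has #|F|.-1.-primitive_root [seq x <- enum F | x != 0].
  by exists (w ^+ (#|F|.-1 %/ n)); exact: dvdn_prim_root.
apply: cyclic.has_prim_root => //; last first.
- rewrite size_filter; have := count_predC (pred1 (0 : F)) (enum F).
  by rewrite -cardE count_uniq_mem ?enum_uniq // mem_enum /= => <-; rewrite add1n.
- by rewrite filter_uniq // enum_uniq.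
apply/allP => x; rewrite mem_filter => /andP[x0 _].
rewrite unity_rootE; apply/eqP/(mulfI x0).
by rewrite -exprS prednK ?expf_card ?mulr1 //; lia.
Qed.

(** * Frobenius and the group mu_(q+1) in the field with q^2 elements *)

Section QuadraticFiniteField.
Variables (F : finFieldType) (q : nat).
Hypothesis hq : exists p e : nat, [/\ prime p, (0 < e)%N & q = (p ^ e)%N].
Hypothesis hF : #|F| = (q ^ 2)%N.

Lemma q_gt1 : (1 < q)%N.
Proof.
case: hq => p [e [p_pr e_gt0 ->]].
by rewrite -(prednK e_gt0) expnS (leq_trans (prime_gt1 p_pr)) // leq_pmulr // expn_gt0 prime_gt0.
Qed.

Lemma cardF1 : #|F|.-1 = (q.-1 * q.+1)%N.
Proof. by rewrite hF; have := q_gt1; nia. Qed.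

Lemma frobD (x y : F) : (x + y) ^+ q = x ^+ q + y ^+ q.
Proof.
case: hq => p [e [p_pr _ qE]]; apply: exprDn_pchar.
rewrite qE pnatX; apply/orP; left.
have pF : p \in [pchar F] by apply: (@card_finPcharP F p (e * 2)%N); rewrite // hF qE expnM.
by rewrite (eq_pnat _ (pcharf_eq pF)) pnat_id.
Qed.

Lemma frob_sum (I : Type) (s : seq I) (P : pred I) (f : I -> F) :
  (\sum_(i <- s | P i) f i) ^+ q = \sum_(i <- s | P i) f i ^+ q.
Proof.
by apply: (big_morph (fun x => x ^+ q) frobD); rewrite expr0n gtn_eqF // ltnW // q_gt1.
Qed.

Lemma frob_unity (x : F) : x ^+ q.+1 = 1 -> x ^+ q = x^-1.
Proof.
move=> xq; have x0 := unity_neq0 (ltn0Sn _) xq.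
by apply: (mulfI x0); rewrite -exprS xq divff.
Qed.

Lemma expq1_unity (X : F) : X != 0 -> (X ^+ q.-1) ^+ q.+1 = 1.
Proof.
move=> X0; rewrite -exprM -cardF1; apply: (mulfI X0).
by rewrite -exprS prednK ?expf_card ?mulr1 //; rewrite (ltn_trans _ (finNzRing_gt1 F)).
Qed.

(** Write [x = w ^+ i] with [w] a generator of the multiplicative group, of order (q-1)(q+1);
    [x ^+ q.+1 = 1] then forces q-1 to divide [i]. *)
Lemma unity_expq1 (x : F) : x ^+ q.+1 = 1 -> exists2 X : F, X != 0 & X ^+ q.-1 = x.
Proof.
move=> xq; have [w wP] := finField_prim_root (dvdnn #|F|.-1).
have := q_gt1 => q1.
have x1 : x ^+ #|F|.-1 = 1 by rewrite cardF1 mulnC exprM xq expr1n.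
have [i xE] := prim_rootP wP x1.
have : (q.-1 %| i)%N.
  rewrite -(@dvdn_pmul2r q.+1) // -cardF1 (prim_order_dvd wP) exprM -xE.
  by rewrite xq.
case/dvdnP => j ij; exists (w ^+ j); last by rewrite -exprM -ij -xE.
by rewrite expf_neq0 // (unity_neq0 (prim_order_gt0 wP) (prim_expr_order wP)).
Qed.

Lemma unity_prim_root n : (n %| q.+1)%N -> exists w : F, n.-primitive_root w.
Proof. by move=> n_dvd; apply: finField_prim_root; rewrite cardF1 dvdn_mull. Qed.

(** * Reduction from permuting the field to injectivity on mu_(q+1) *)

Section PermutationCriterion.
Variables (r : nat) (h : {poly F}).
Hypothesis hr : (0 < r)%N.
Let f X := ('X^r * (h \Po 'X^(q.-1))).[X].
Let g x := x ^+ r * h.[x] ^+ q.-1.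

Let fE X : f X = X ^+ r * h.[X ^+ q.-1].
Proof. by rewrite /f hornerM horner_comp !hornerXn. Qed.

Let f0 : f 0 = 0.
Proof. by rewrite fE expr0n gtn_eqF // mul0r. Qed.

Let f_expq1 X : f X ^+ q.-1 = g (X ^+ q.-1).
Proof. by rewrite fE /g exprMn exprAC. Qed.

(* x |-> x^(q-1) is onto mu_(q+1) with fibres the F_q^*-cosets, on which the map acts as u |-> u^r. *)
Lemma perm_polyP : perm_poly ('X^r * (h \Po 'X^(q.-1))) <->
  [/\ coprime r q.-1,
      forall x : F, x ^+ q.+1 = 1 -> h.[x] != 0
    & forall x y : F, x ^+ q.+1 = 1 -> y ^+ q.+1 = 1 -> g x = g y -> x = y].
Proof.
have q1 := q_gt1; have q10 : (0 < q.-1)%N by lia.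
split=> [f_inj | [cop h_neq0 g_inj]].
  have h_neq0 x : x ^+ q.+1 = 1 -> h.[x] != 0.
    case/unity_expq1 => X X0 <-; apply: contra X0 => /eqP hX.
    by apply/eqP/f_inj; rewrite -/(f X) -/(f 0) f0 fE hX mulr0.
  have cop : coprimez r%:Z q.-1%:Z.
    have [w wP] : exists w : F, q.-1.-primitive_root w.
      by apply: finField_prim_root; rewrite cardF1 dvdn_mulr.
    apply: (unity_eq1_coprimez wP) => z zq zr; apply: f_inj.
    by rewrite -/(f z) -/(f 1) !fE zq exprnP zr !expr1n.
  split=> [|//|x y xq yq]; first by move: cop; rewrite coprimezE.
  case/unity_expq1: (xq) => X X0 XE; case/unity_expq1: (yq) => Y Y0 YE gxy.
  have fY0 : f Y != 0 by rewrite fE YE mulf_neq0 ?expf_neq0 ?h_neq0.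
  have fXY : (f X / f Y) ^+ q.-1 = 1.
    by rewrite exprMn exprVn !f_expq1 XE YE gxy divff // -YE -f_expq1 expf_neq0.
  (* Correct [Y] inside its fibre: [v] has trivial (q-1)-th power and [v ^ r] is the ratio of the
     two values, so [v * Y] and [X] have the same image under [f]. *)
  have [v vq vr] := coprimez_unity_root q10 cop fXY.
  suff vYX : v * Y = X by rewrite -XE -vYX exprMn vq mul1r YE.
  apply: f_inj; rewrite -/(f X) -/(f (v * Y)) fE !exprMn vq mul1r (exprnP v) vr.
  by rewrite -mulrA -fE divfK.
move=> X Y; rewrite -/(f X) -/(f Y) => fXY.
have f_eq0 Z : f Z = 0 -> Z = 0.
  move/eqP; rewrite fE mulf_eq0 expf_eq0 hr /=; case/orP => [/eqP //|].
  by case: (eqVneq Z 0) => // Z0; rewrite (negPf (h_neq0 _ (expq1_unity Z0))).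
have [Y0|Y0] := eqVneq Y 0; first by rewrite Y0; apply: f_eq0; rewrite fXY Y0.
have [X0|X0] := eqVneq X 0; first by rewrite X0 (f_eq0 Y) // -fXY X0.
have XYq : X ^+ q.-1 = Y ^+ q.-1.
  by apply: g_inj; rewrite ?expq1_unity // -!f_expq1 fXY.
have XYr : X ^+ r = Y ^+ r.
  by move: fXY; rewrite !fE XYq => /mulIf; apply; rewrite h_neq0 // expq1_unity.
apply: (divIf Y0); rewrite divff //.
apply: (@coprimez_unity_eq1 _ q.-1 r%:Z) => //.
  by rewrite exprMn exprVn XYq divff // expf_neq0.
by rewrite -exprnP exprMn exprVn XYr divff // expf_neq0.
Qed.

End PermutationCriterion.
End QuadraticFiniteField.

(** * The classes A_k and self-reciprocal polynomials *)

Section SelfReciprocal.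
Variables (F : finFieldType) (q d : nat) (eps : F).
Hypothesis hq : exists p e : nat, [/\ prime p, (0 < e)%N & q = (p ^ e)%N].
Hypothesis hF : #|F| = (q ^ 2)%N.
Hypothesis hd0 : (0 < d)%N.
Hypothesis hdq : (d %| q.+1)%N.
Hypothesis heps : d.-primitive_root eps.
Let m := (q.+1 %/ d)%N.
Implicit Types (k t tau : nat) (x lam : F) (L : {poly F}).

Let mdE : (m * d)%N = q.+1. Proof. exact: divnK. Qed.
Let m_gt0 : (0 < m)%N. Proof. by rewrite divn_gt0 // dvdn_leq. Qed.

Lemma Aset_unity k x : x ^+ m = eps ^+ k -> x ^+ q.+1 = 1.
Proof. by move=> xm; rewrite -mdE exprM xm exprAC (prim_expr_order heps) expr1n. Qed.

Lemma AsetE k x : Aset q d eps k x = (x ^+ m == eps ^+ k).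
Proof.
rewrite /Aset; apply: andb_idl => /eqP /Aset_unity ->; exact: eqxx.
Qed.

Lemma Aset_neq0 k x : x ^+ m = eps ^+ k -> x != 0.
Proof. by move/Aset_unity; apply: unity_neq0. Qed.

Lemma unity_Aset x : x ^+ q.+1 = 1 -> exists k : 'I_d, x ^+ m = eps ^+ k.
Proof.
rewrite -mdE exprM => xmd; have [k kE] := prim_rootP heps xmd; by exists k.
Qed.

Lemma Aset_nonempty k : exists x, x ^+ m = eps ^+ k.
Proof.
have [w wP] := unity_prim_root hq hF (dvdnn q.+1).
have : d.-primitive_root (w ^+ m) by exact: dvdn_prim_root.
move=> /prim_rootP /(_ (eps ^+ k)) [].
  by rewrite exprAC (prim_expr_order heps) expr1n.
by move=> i ->; exists (w ^+ i); rewrite exprAC.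
Qed.

(** A_k is a coset of mu_m: one point [x0] times the powers of a primitive [m]-th root of unity.
    These [m] distinct points drive both interpolation and factorization below. *)
Lemma Aset_seq k : exists rs : seq F,
  [/\ uniq rs, size rs = m & forall x, x \in rs -> x ^+ m = eps ^+ k].
Proof.
have m_dvd : (m %| q.+1)%N by rewrite -mdE dvdn_mulr.
have [w wP] := unity_prim_root hq hF m_dvd.
have [x0 x0m] := Aset_nonempty k; have x00 := Aset_neq0 x0m.
exists [seq x0 * w ^+ i | i <- iota 0 m]; split; last 2 first.
- by rewrite size_map size_iota.
- move=> x /mapP[i _ ->]; rewrite exprMn x0m exprAC.
  by rewrite (prim_expr_order wP) expr1n mulr1.
rewrite map_inj_in_uniq ?iota_uniq // => i j; rewrite !mem_iota !add0n /=.
move=> ltim ltjm /(mulfI x00) /eqP; rewrite (eq_prim_root_expr wP).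
by rewrite !modn_small // => /eqP.
Qed.

Lemma Aset_poly_eq k (A B : {poly F}) : (size A <= m)%N -> (size B <= m)%N ->
  (forall x, x ^+ m = eps ^+ k -> A.[x] = B.[x]) -> A = B.
Proof.
move=> sA sB eqAB; have [rs [rs_uniq rs_size rs_m]] := Aset_seq k.
apply/eqP; rewrite -subr_eq0; apply/eqP/(@roots_geq_poly_eq0 _ _ rs) => //.
  apply/allP => x /rs_m xm; rewrite /root hornerD hornerN eqAB //.
  by rewrite subrr.
by rewrite rs_size (leq_trans (size_polyD _ _)) // size_polyN geq_max sA.
Qed.

(** ['X^m - eps^k] splits into distinct linear factors whose roots are the [m] points of A_k. *)
Lemma coprimep_AsetP k L : coprimep L ('X^m - (eps ^+ k)%:P) <->
  (forall x, x ^+ m = eps ^+ k -> L.[x] != 0).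
Proof.
split=> [cop x xm | L_neq0].
  apply: (coprimep_root (p := 'X^m - (eps ^+ k)%:P)); rewrite 1?coprimep_sym //.
  by rewrite /root !hornerE xm subrr.
have [rs [rs_uniq rs_size rs_m]] := Aset_seq k.
have -> : 'X^m - (eps ^+ k)%:P = \prod_(z <- rs) ('X - z%:P).
  rewrite -[RHS]scale1r -{1}(lead_coefXnsubC (eps ^+ k) m_gt0).
  apply: all_roots_prod_XsubC; rewrite ?uniq_rootsE ?size_XnsubC ?rs_size //.
  by apply/allP => x /rs_m xm; rewrite /root !hornerE xm subrr.
rewrite big_seq; apply: (big_ind (fun p => coprimep L p)).
- exact: coprimep1.
- by move=> p1 p2 c1 c2; rewrite coprimepMr c1.
- by move=> x /rs_m xm; rewrite coprimep_XsubC; apply: L_neq0.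
Qed.

(** On mu_(q+1) Frobenius inverts [x], so [L.[x] ^+ q] is the sum of the conjugate coefficients
    times [x^(-i)]; multiplying by [x^(deg L)] reverses the exponents. *)
Lemma horner_tilde L x : x ^+ q.+1 = 1 ->
  (tilde q L).[x] = x ^+ (size L).-1 * L.[x] ^+ q.
Proof.
move=> xq; have x0 := unity_neq0 (ltn0Sn q) xq.
rewrite horner_poly horner_coef (frob_sum hq hF) mulr_sumr; move: (size L) => n.
rewrite (reindex_inj rev_ord_inj) /=; apply: eq_bigr => i _.
have lt_i := ltn_ord i.
have -> : (n.-1 - (n - i.+1) = i)%N by lia.
rewrite exprMn exprAC (frob_unity xq) mulrCA; congr (_ * _).
have -> : (n.-1 = (n - i.+1) + i)%N by lia.
by rewrite exprD -mulrA -exprMn divff // expr1n mulr1.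
Qed.

Lemma frob_self_reciprocal n (mu : F) L x : size L = n.+1 ->
  tilde q L = mu *: L -> x ^+ q.+1 = 1 ->
  L.[x] ^+ q = mu * x ^ (- n%:Z) * L.[x].
Proof.
move=> sL tL xq; have x0 := unity_neq0 (ltn0Sn q) xq.
apply: (mulfI (expf_neq0 n x0)).
have := horner_tilde L xq; rewrite sL /= tL hornerZ => <-.
by rewrite -exprnN; field; rewrite ?expf_neq0.
Qed.

(** For nonzero [tau] the summands P and X^(m-tau) Q acquire the same factor: the [eps ^+ k] in the
    relation for Q equals [x ^+ m], which compensates for the conjugate of [x ^+ (m - tau)]. *)
Lemma Lset_frob k t tau lam L x : (t < m)%N ->
  tau = 0%N \/ (m - t <= tau <= t)%N -> Lset q d eps k t tau lam L ->
  x ^+ m = eps ^+ k ->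
  L.[x] != 0 /\ L.[x] ^+ q = lam * x ^ (tau%:Z - t%:Z) * L.[x].
Proof.
move=> ltm tau_cond; rewrite /Lset -/m => HL xm.
have x0 := Aset_neq0 xm; have xq := Aset_unity xm.
move: HL; have [-> [sL tL /coprimep_AsetP copL]|tau0] := eqVneq tau 0%N.
  by split; [exact: copL | rewrite sub0r; apply: frob_self_reciprocal].
case=> P [Q [LE [sP tP sQ tQ /coprimep_AsetP copL]]]; split; first exact: copL.
have {}tau_cond : (m - t <= tau <= t)%N by case: tau_cond => // tauE; rewrite tauE in tau0.
rewrite LE hornerD hornerM hornerXn (frobD hq hF) exprMn.
rewrite (frob_self_reciprocal sP tP xq) (frob_self_reciprocal sQ tQ xq).
rewrite exprAC (frob_unity xq) -xm mulrDr; congr (_ + _).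
  by congr (_ * x ^ _ * _); lia.
rewrite mulrA; rewrite [RHS]mulrA; congr (_ * _).
rewrite exprVn exprnN !exprnP mulrA mulrCA -!mulrA -!expfzDr //.
by congr (_ * x ^ _); lia.
Qed.

(* With L = P + X^(m-tau) Q, deg P < m - tau, both tilde L and lam (X^tau P + eps^k Q) have degree
   less than m, so that agreement at the m points of A_k makes them equal. *)
Lemma self_reciprocal_Lset k t tau lam L :
    size L = t.+1 -> L`_0 != 0 -> (t < m)%N -> (tau < m)%N -> lam != 0 ->
    coprimep L ('X^m - (eps ^+ k)%:P) ->
    (forall x, x ^+ m = eps ^+ k -> (tilde q L).[x] = lam * x ^+ tau * L.[x]) ->
  (tau = 0%N \/ (m - t <= tau <= t)%N) /\ Lset q d eps k t tau lam L.
Proof.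
move=> sL L0 lt_tm tau_m lam_n0 copL tL_eval.
pose P := take_poly (m - tau) L; pose Q := drop_poly (m - tau) L.
have LE : L = P + 'X^(m - tau) * Q by rewrite mulrC poly_take_drop.
have L_ge i : (t < i)%N -> L`_i = 0 by move=> ?; rewrite nth_default // sL.
have tLE : tilde q L = lam *: ('X^tau * P + eps ^+ k *: Q).
  apply: (@Aset_poly_eq k).
  - by rewrite (leq_trans (size_poly _ _)) // sL; lia.
  - apply/leq_sizeP => i le_i; rewrite !coefE.
    have -> : (i < tau)%N = false by lia.
    have -> : (i - tau < m - tau)%N = false by lia.
    by rewrite L_ge; [rewrite !mulr0 addr0 mulr0 | lia].
  - move=> x xm; rewrite tL_eval // LE !hornerE -mulrA -xm.
    by rewrite -[in x ^+ m](subnKC (ltnW tau_m)) exprD; ring.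
have tL_coef i : (i <= t)%N -> (tilde q L)`_i = L`_(t - i) ^+ q.
  by move=> le_i; rewrite coef_poly sL ltnS le_i.
have tL_ge i : (t < i)%N -> (tilde q L)`_i = 0.
  by move=> lt_i; rewrite coef_poly sL ltnS leqNgt lt_i.
have tL_lo i : (i < tau)%N -> (tilde q L)`_i = lam * eps ^+ k * Q`_i.
  by move=> lt_i; rewrite tLE !coefE lt_i add0r mulrA.
have tL_hi i : (tau <= i < m)%N -> (tilde q L)`_i = lam * P`_(i - tau).
  move=> /andP[le_i lt_i]; rewrite tLE coefZ coefD coefXnM coefZ coef_drop_poly.
  by rewrite ltnNge le_i /= L_ge ?mulr0 ?addr0 //; lia.
have [tau0|tau_n0] := eqVneq tau 0%N.
  split; first by left.
  rewrite /Lset tau0 /=; split => //.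
  apply/polyP => i; have [lt_i|ge_i] := ltnP i m.
    by rewrite tL_hi ?tau0 // subn0 coef_take_poly tau0 subn0 lt_i coefZ.
  have lt_i : (t < i)%N by lia.
  by rewrite tL_ge ?coefZ ?L_ge ?mulr0.
have Lt_n0 : L`_t != 0 by rewrite -[t]/(t.+1.-1) -sL -/(lead_coef L) lead_coef_eq0 -size_poly_gt0 sL.
have q_n0 : (0 < q)%N := ltnW (q_gt1 hq).
(* Otherwise Q vanishes, and with it the constant coefficient of [tilde q L], which is the conjugate
   of the leading coefficient of [L]. *)
have le_mt : (m - tau <= t)%N.
  rewrite leqNgt; apply/negP => lt_t; move: (tL_lo 0%N).
  rewrite lt0n tau_n0 tL_coef // subn0 coef_drop_poly (@L_ge (0 + (m - tau))%N); last by lia.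
  by move=> /(_ isT) /eqP; rewrite mulr0 expf_eq0 (negPf Lt_n0) andbF.
have le_tau : (tau <= t)%N.
  rewrite leqNgt; apply/negP => lt_t; move: (tL_hi tau).
  rewrite leqnn tau_m tL_ge // subnn coef_take_poly subn_gt0 tau_m => /(_ isT) /eqP.
  by rewrite eq_sym mulf_eq0 (negPf lam_n0) (negPf L0).
have P_ge i : (t - tau < i)%N -> P`_i = 0.
  move=> lt_i; rewrite coef_take_poly; case: ifP => // lt_im.
  have : lam * P`_i = 0 by rewrite -[i](addKn tau) -tL_hi ?tL_ge //; lia.
  by move/eqP; rewrite mulf_eq0 (negPf lam_n0) /= coef_take_poly lt_im => /eqP.
have P_last : P`_(t - tau) != 0.
  have : lam * P`_(t - tau) != 0.
    by rewrite -tL_hi ?tL_coef ?subnn ?expf_neq0 //; lia.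
  by rewrite mulf_eq0 negb_or => /andP[].
have sP : size P = (t - tau).+1.
  apply/eqP; rewrite eqn_leq; apply/andP; split; first exact/leq_sizeP.
  by rewrite ltnNge; apply: contra P_last => le_sz; rewrite nth_default.
have sQ : size Q = (tau + t - m).+1 by rewrite size_drop_poly sL; lia.
split; first by right; rewrite le_tau andbT leq_subCl.
(* The reciprocity of P is read off the coefficients of [tilde q L] from index [tau] on, that of Q
   off those below [tau]. *)
rewrite /Lset (negPf tau_n0) -/m; exists P, Q; split=> //; split=> //.
  apply/polyP => i; rewrite coefZ coef_poly sP ltnS /=.
  case: (leqP i (t - tau)) => [le_i|/P_ge->]; last by rewrite mulr0.
  rewrite -{2}[i](addKn tau) -tL_hi ?tL_coef; do ?lia.
  by rewrite coef_take_poly ifT ?subnDA //; lia.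
apply/polyP => i; rewrite coefZ coef_poly sQ ltnS /=.
case: (leqP i (tau + t - m)) => [le_i|lt_i]; last by rewrite [Q`_i]nth_default ?mulr0 ?sQ.
rewrite -tL_lo ?tL_coef; do ?lia.
by rewrite coef_drop_poly; congr (L`_ _ ^+ q); lia.
Qed.

(** Produces the data of condition (i) for one class, starting from a monomial ratio between [N.[x]
    ^+ q] and [N.[x]]. *)
Lemma frob_Lset_exists k (N : {poly F}) (c : F) (z : int) :
    (size N <= m)%N -> (forall x, x ^+ m = eps ^+ k -> N.[x] != 0) ->
    (forall x, x ^+ m = eps ^+ k -> N.[x] ^+ q = c * x ^ z * N.[x]) ->
  exists s t tau lam L,
  [/\ (s + t < m)%N, lam ^+ q.+1 = 1, tau = 0%N \/ (m - t <= tau <= t)%N,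
      N = 'X^s * L & Lset q d eps k t tau lam L].
Proof.
move=> sN N_neq0 N_frob.
have [y ym] := Aset_nonempty k; have y0 := Aset_neq0 ym.
have yq := Aset_unity ym.
have N0 : N != 0 by apply: contra (N_neq0 _ ym) => /eqP ->; rewrite horner0.
(* [s] is the multiplicity of 0 as a root of [N], so the cofactor [L] has nonzero constant term. *)
have [s [L /implyP/(_ N0) L0 NE]] := multiplicity_XsubC N 0.
rewrite subr0 in NE; rewrite /root horner_coef0 in L0.
have Ln0 : L != 0 by apply: contra L0 => /eqP ->; rewrite coef0.
pose t := (size L).-1; have sL : size L = t.+1 by rewrite /t -polySpred.
have stm : (s + t < m)%N.
  by move: sN; rewrite NE size_mulXn // sL; lia.
have L_neq0 x : x ^+ m = eps ^+ k -> L.[x] != 0.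
  by move=> /N_neq0; rewrite NE hornerM mulf_eq0 negb_or => /andP[].
have m0 : m%:Z != 0 by lia.
(* Conjugating [x ^+ s] and moving it across contributes [2 * s], and passing from [L.[x] ^+ q] to
   [tilde q L] contributes [t]. Since [x ^+ m = eps ^+ k] on A_k, the quotient of [z'] by [m] goes
   into the constant [lam] and the remainder is [tau]. *)
pose z' := z + 2 * s%:Z + t%:Z; pose j := (z' %/ m%:Z)%Z.
have [tau tauE] : exists tau : nat, (z' %% m%:Z)%Z = tau%:Z.
  by have := modz_ge0 z' m0; case: (z' %% m%:Z)%Z => // tau _; exists tau.
have tau_m : (tau < m)%N by have := ltz_mod z' m0; rewrite tauE; lia.
pose lam := c * (eps ^+ k) ^ j.
have z'E x : x ^+ m = eps ^+ k -> c * x ^ z' = lam * x ^+ tau.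
  move=> xm; rewrite (divz_eq z' m%:Z) tauE expfzDr ?(Aset_neq0 xm) //.
  by rewrite expfz_nat_mul xm mulrA.
have tL_eval x : x ^+ m = eps ^+ k -> (tilde q L).[x] = lam * x ^+ tau * L.[x].
  move=> xm; have x0 := Aset_neq0 xm; have xq := Aset_unity xm.
  rewrite (horner_tilde L xq) -/t -(z'E _ xm).
  have := N_frob _ xm; rewrite NE hornerM hornerXn exprMn exprAC (frob_unity xq).
  move=> H; apply: (mulIf (expf_neq0 s (invr_neq0 x0))).
  have X2s : x ^ (2 * s%:Z) = x ^+ s * x ^+ s.
    by rewrite -exprD exprnP; congr (_ ^ _); lia.
  rewrite -[LHS]mulrA H /z' (expfzDr _ t x0) (expfzDr z _ x0) X2s exprVn -exprnP.
  by move: (x ^ z) => xz; field; rewrite expf_neq0.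
have lam_n0 : lam != 0.
  have : L.[y] ^+ q * y ^+ t != 0 by rewrite mulf_neq0 ?expf_neq0 ?L_neq0.
  by rewrite mulrC -(horner_tilde L yq) tL_eval // !mulf_eq0 !negb_or -andbA => /andP[].
have lamq : lam ^+ q.+1 = 1.
  (* Take (q+1)-th powers at one point: those of [y] become 1, and [L.[y]] and its conjugate have
     the same norm because the field has q^2 elements. *)
  have := horner_tilde L yq; rewrite tL_eval // => /(congr1 (fun a => a ^+ q.+1)).
  have LyN : (L.[y] ^+ q) ^+ q.+1 = L.[y] ^+ q.+1.
    have -> : (L.[y] ^+ q) ^+ q.+1 = L.[y] ^+ (q ^ 2)%N * L.[y] ^+ q.
      by rewrite -mulnn -exprM mulnSr exprD.
    by rewrite -hF expf_card exprS.
  rewrite !exprMn LyN (exprAC y tau) (exprAC y (size L).-1) yq !expr1n mul1r mulr1.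
  by rewrite -[RHS]mul1r => /mulIf; apply; rewrite expf_neq0 // L_neq0.
exists s, t, tau, lam, L.
have copL : coprimep L ('X^m - (eps ^+ k)%:P) by apply/coprimep_AsetP.
have lt_tm : (t < m)%N := leq_ltn_trans (leq_addl s t) stm.
have [tau_cond HL] := self_reciprocal_Lset sL L0 lt_tm tau_m lam_n0 copL tL_eval.
by split; rewrite 1?mulrC.
Qed.

(** * Monomial values on the classes A_k and injectivity across them *)

Lemma Lset_expq1 k r s t tau lam (N L : {poly F}) x : (s + t < m)%N ->
  tau = 0%N \/ (m - t <= tau <= t)%N -> N = 'X^s * L ->
  Lset q d eps k t tau lam L -> x ^+ m = eps ^+ k ->
  N.[x] != 0 /\ x ^+ r * N.[x] ^+ q.-1 = lam * x ^ (ek r s t tau).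
Proof.
move=> stm tau_cond NE HL xm.
have [Lx0 Lxq] := Lset_frob (leq_ltn_trans (leq_addl s t) stm) tau_cond HL xm.
have x0 := Aset_neq0 xm.
have Nx0 : N.[x] != 0 by rewrite NE hornerM hornerXn mulf_neq0 // expf_neq0.
(* Multiplying by [N.[x]] turns the exponent q-1 into q, where Frobenius applies. *)
split=> //; apply: (mulIf Nx0); rewrite -mulrA -exprSr prednK; last first.
  by rewrite ltnW // (q_gt1 hq).
rewrite NE hornerM hornerXn exprMn exprAC (frob_unity (Aset_unity xm)) Lxq.
have -> : ek r s t tau = r%:Z + (tau%:Z - t%:Z) + (- s%:Z) + (- s%:Z).
  by rewrite /ek; lia.
rewrite (expfzDr _ (- s%:Z) x0) (expfzDr (_ + _) (- s%:Z) x0) (expfzDr r _ x0).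
rewrite -exprnP -exprnN exprVn; move: (x ^ _) => y.
by field; rewrite expf_neq0.
Qed.

(** On [m]-th powers, [g] acts on class indices by [k |-> pi k + e k * k]; inside one class it is a
    constant times an [e k]-th power, injective exactly when [e k] is prime to [m]. *)
Lemma Aset_monomial_injP (g : F -> F) (lam : 'I_d -> F) (pi : 'I_d -> 'I_d)
    (e : 'I_d -> int) :
  (forall k : 'I_d, lam k ^+ m = eps ^+ pi k) ->
  (forall (k : 'I_d) x, x ^+ m = eps ^+ k -> g x = lam k * x ^ e k) ->
  (forall x y, x ^+ q.+1 = 1 -> y ^+ q.+1 = 1 -> g x = g y -> x = y) <->
  (forall k : 'I_d, coprimez (e k) m%:Z) /\
  injective (fun k : 'I_d => (((pi k)%:Z + e k * k%:Z) %% d%:Z)%Z).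
Proof.
move=> lamE gE.
have lam0 (k : 'I_d) : lam k != 0 by exact: Aset_neq0 (lamE k).
have eps0 : eps != 0 by exact: unity_neq0 hd0 (prim_expr_order heps).
have gm (k : 'I_d) x : x ^+ m = eps ^+ k ->
    g x ^+ m = eps ^ ((pi k)%:Z + e k * k%:Z).
  move=> xm; rewrite (gE _ _ xm) exprMn lamE [(x ^ _) ^+ m]exprnP exprzAC -exprnP xm.
  by rewrite (expfzDr _ _ eps0) expfz_nat_mul.
have idxE (k1 k2 : 'I_d) : (((pi k1)%:Z + e k1 * k1%:Z) %% d%:Z)%Z =
    (((pi k2)%:Z + e k2 * k2%:Z) %% d%:Z)%Z ->
    eps ^ ((pi k1)%:Z + e k1 * k1%:Z) = eps ^ ((pi k2)%:Z + e k2 * k2%:Z).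
  by move=> E; rewrite -(prim_expz_mod _ heps) E (prim_expz_mod _ heps).
have eps_inj (k1 k2 : 'I_d) : eps ^+ k1 = eps ^+ k2 -> k1 = k2.
  move/eqP; rewrite (eq_prim_root_expr heps) !modn_small // => /eqP.
  exact: val_inj.
split=> [g_inj | [e_cop idx_inj] x y xq yq gxy].
  have e_cop (k : 'I_d) : coprimez (e k) m%:Z.
    have m_dvd : (m %| q.+1)%N by rewrite -mdE dvdn_mulr.
    have [w wP] := unity_prim_root hq hF m_dvd.
    (* Multiplying a point of A_k by such a [z] stays in A_k and leaves [g] unchanged. *)
    apply: (unity_eq1_coprimez wP) => z zm ze.
    have [x xm] := Aset_nonempty k.
    have zxm : (z * x) ^+ m = eps ^+ k by rewrite exprMn zm mul1r.
    apply: (mulIf (Aset_neq0 xm)); rewrite mul1r.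
    apply: g_inj; rewrite ?(Aset_unity xm) ?(Aset_unity zxm) //.
    by rewrite (gE _ _ xm) (gE _ _ zxm) expfzMl ze mul1r.
  split=> // k1 k2 /idxE E.
  have [x1 x1m] := Aset_nonempty k1; have [x2 x2m] := Aset_nonempty k2.
  have gx2_0 : g x2 != 0 by rewrite (gE _ _ x2m) mulf_neq0 ?expfz_neq0 ?(Aset_neq0 x2m).
  (* Equal indices put both values in one class, so their ratio is an [m]-th root of unity and hence
     some [z ^ e k2]. Then [z * x2], still in the class of [k2], collides with [x1]. *)
  have w1 : (g x1 / g x2) ^+ m = 1.
    by rewrite exprMn exprVn (gm _ _ x1m) (gm _ _ x2m) E divff // expfz_neq0.
  have [z zm ze] := coprimez_unity_root m_gt0 (e_cop k2) w1.
  have zx2m : (z * x2) ^+ m = eps ^+ k2 by rewrite exprMn zm mul1r.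
  apply: eps_inj; rewrite -x1m -zx2m; congr (_ ^+ m).
  apply: g_inj; rewrite ?(Aset_unity x1m) ?(Aset_unity zx2m) //.
  by rewrite (gE _ _ zx2m) expfzMl ze mulrCA -(gE _ _ x2m) divfK.
have [k1 xm] := unity_Aset xq; have [k2 ym] := unity_Aset yq.
have y0 := Aset_neq0 ym.
have k12 : k1 = k2.
  apply/idx_inj/eqP; rewrite -(eq_prim_root_expz _ _ heps).
  by rewrite -(gm _ _ xm) -(gm _ _ ym) gxy.
subst k2; apply: (divIf y0); rewrite divff //.
apply: (coprimez_unity_eq1 m_gt0 (e_cop k1)).
  by rewrite exprMn exprVn xm ym divff // expf_neq0.
move: gxy; rewrite (gE _ _ xm) (gE _ _ ym) => /(mulfI (lam0 k1)) xye.
by rewrite expfzMl xye -expfzMl divff // exp1rz.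
Qed.

Lemma horner_Aset (a : 'I_m -> 'I_d -> F) k x : x ^+ m = eps ^+ k ->
  (\sum_(i < m) \sum_(j < d) a i j *: 'X^(i + j * m)).[x] =
  (\sum_(i < m) (\sum_(j < d) a i j * eps ^+ (j * k)) *: 'X^i).[x].
Proof.
move=> xm; rewrite !horner_sum; apply: eq_bigr => i _.
rewrite horner_sum hornerZ mulr_suml; apply: eq_bigr => j _.
rewrite hornerZ !hornerXn exprD [(j * m)%N]mulnC exprM xm -exprM [(k * j)%N]mulnC.
by rewrite -mulrA; congr (_ * _); rewrite mulrC.
Qed.

End SelfReciprocal.

(** * Equivalence with conditions (i), (ii) and (iii) *)

Theorem theorem2p3 (F : finFieldType) (q d r : nat) (eps : F)
  (hq : exists p e : nat, [/\ prime p, (0 < e)%N & q = (p ^ e)%N])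
  (hF : #|F| = (q ^ 2)%N) (hd0 : (0 < d)%N) (hdq : (d %| q.+1)%N)
  (heps : d.-primitive_root eps) (hr : (0 < r)%N)
  (a : 'I_(q.+1 %/ d) -> 'I_d -> F) :
  let m := (q.+1 %/ d)%N in
  let h : {poly F} := \sum_(i < m) \sum_(j < d) a i j *: 'X^(i + j * m) in
  let M := fun (i : 'I_m) (k : 'I_d) => \sum_(j < d) a i j * eps ^+ (j * k) in
  (perm_poly ('X^r * (h \Po 'X^(q.-1))) /\
   forall k : 'I_d, exists (c : F) (n : int),
     forall x : F, Aset q d eps k x -> x ^+ r * h.[x] ^+ q.-1 = c * x ^ n)
  <->
  (exists (s t : 'I_d -> nat) (pi : 'I_d -> 'I_d) (lam : 'I_d -> F)
          (tau : 'I_d -> nat),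
     [/\ forall k : 'I_d,
           [/\ (s k + t k < m)%N, Aset q d eps (pi k) (lam k),
               tau k = 0%N \/ (m - t k <= tau k <= t k)%N
             & exists L : {poly F},
                 \sum_(i < m) M i k *: 'X^i = 'X^(s k) * L /\
                 Lset q d eps k (t k) (tau k) (lam k) L],
         coprime r q.-1,
         forall k : 'I_d, coprimez (ek r (s k) (t k) (tau k)) m
       & injective (fun k : 'I_d =>
            (((pi k)%:Z + ek r (s k) (t k) (tau k) * k%:Z) %% d%:Z)%Z)]).
Proof.
move=> m h M; set N := fun k : 'I_d => \sum_(i < m) M i k *: 'X^i : {poly F}.
have hE (k : 'I_d) x : x ^+ m = eps ^+ k -> h.[x] = (N k).[x].
  exact: horner_Aset.
have AE := AsetE hdq heps.
have A_unity := Aset_unity hdq heps.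
split=> [[/(perm_polyP hq hF _ hr) [cop h_neq0 g_inj] g_mon] |
         [s [t [pi [lam [tau [cond_i cop e_cop idx_inj]]]]]]]; last first.
  have gE (k : 'I_d) x : x ^+ m = eps ^+ k ->
      h.[x] != 0 /\ x ^+ r * h.[x] ^+ q.-1 = lam k * x ^ ek r (s k) (t k) (tau k).
    move=> xm; rewrite (hE _ _ xm).
    have [stm _ tau_cond [L [NE HL]]] := cond_i k.
    exact: (Lset_expq1 hq hF hd0 hdq heps r stm tau_cond NE HL xm).
  split; last first.
    move=> k; exists (lam k), (ek r (s k) (t k) (tau k)) => x.
    by rewrite AE => /eqP /gE[].
  apply/(perm_polyP hq hF _ hr); split=> //.
    by move=> x /(unity_Aset hdq heps) [k /gE[]].
  apply/(@Aset_monomial_injP F q d eps hq hF hd0 hdq heps _ lam pi).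
  - by move=> k; have [_ ] := cond_i k; rewrite AE => /eqP.
  - by move=> k x /gE[_ ->].
  - by split.
(* The data for one [k] are packed into a single tuple so that one finite choice yields all five
   functions of [k]. *)
have cond_i (k : 'I_d) : exists u : nat * nat * 'I_d * F * nat,
    let: (s, t, pi, lam, tau) := u in
    [/\ (s + t < m)%N, Aset q d eps pi lam, tau = 0%N \/ (m - t <= tau <= t)%N
      & exists L : {poly F}, N k = 'X^s * L /\ Lset q d eps k t tau lam L].
  have [c [n g_mon_k]] := g_mon k.
  have N_neq0 x : x ^+ m = eps ^+ k -> (N k).[x] != 0.
    by move=> xm; rewrite -(hE _ _ xm) h_neq0 // (A_unity k).
  have N_frob x : x ^+ m = eps ^+ k ->
      (N k).[x] ^+ q = c * x ^ (n - r%:Z) * (N k).[x].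
    move=> xm; have x0 := Aset_neq0 hdq heps xm.
    have := g_mon_k x; rewrite AE xm eqxx (hE _ _ xm) => /(_ isT) E.
    apply: (mulfI (expf_neq0 r x0)).
    rewrite -[q in LHS]prednK ?(ltnW (q_gt1 hq)) // exprSr mulrA E expfzDr //.
    rewrite -exprnN; move: (x ^ n) => y.
    by field; rewrite expf_neq0.
  have sN : (size (N k) <= m)%N.
    apply/leq_sizeP => i le_mi; rewrite coef_sum big1 // => j _.
    by rewrite coefZ coefXn gtn_eqF ?mulr0 // (leq_trans (ltn_ord j)).
  have [s [t [tau [lam [L [stm lamq tau_cond NE HL]]]]]] :=
    frob_Lset_exists hq hF hd0 hdq heps sN N_neq0 N_frob.
  have [pi lamE] := unity_Aset hdq heps lamq.
  exists (s, t, pi, lam, tau); split=> //; last by exists L.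
  by rewrite AE; apply/eqP.
have [u uP] := fin_all_exists cond_i.
pose s (k : 'I_d) := (u k).1.1.1.1; pose t (k : 'I_d) := (u k).1.1.1.2.
pose pi (k : 'I_d) := (u k).1.1.2; pose lam (k : 'I_d) := (u k).1.2; pose tau (k : 'I_d) := (u k).2.
have {}uP (k : 'I_d) : [/\ (s k + t k < m)%N, Aset q d eps (pi k) (lam k),
    tau k = 0%N \/ (m - t k <= tau k <= t k)%N
  & exists L, N k = 'X^(s k) * L /\ Lset q d eps k (t k) (tau k) (lam k) L].
  by move: (uP k); rewrite /s /t /pi /lam /tau; case: (u k) => [[[[]]]].
have lamE (k : 'I_d) : lam k ^+ m = eps ^+ pi k.
  by have [_ ] := uP k; rewrite AE => /eqP.
exists s, t, pi, lam, tau.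
have gE (k : 'I_d) x : x ^+ m = eps ^+ k ->
    x ^+ r * h.[x] ^+ q.-1 = lam k * x ^ ek r (s k) (t k) (tau k).
  move=> xm; rewrite (hE _ _ xm).
  have [stm _ tau_cond [L [NE HL]]] := uP k.
  by have [] := Lset_expq1 hq hF hd0 hdq heps r stm tau_cond NE HL xm.
by have [] := (Aset_monomial_injP hq hF hd0 hdq heps lamE gE).1 g_inj.
Qed.
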